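(* For each positive integer $n$, let $f(n)+n+1$ be the maximum size of a $2$-laminar family of subsets of an $n$-element set. Then (a) $\displaystyle\liminf_{n \to \infty} f(n)\binom{n}{2}^{-1} \ge 1.3818$, and (b) $\displaystyle\limsup_{n \to \infty} f(n)\binom{n}{2}^{-1} \le 1.3821$.
   Context: For a positive integer $t$, a family $\mathcal{F}$ of subsets of a set $X$ is called $t$-laminar if whenever $A,B \in \mathcal{F}$ satisfy $|A \cap B| \ge t$, we have $A \subseteq B$ or $B \subseteq A$. *)

(* Defs.v *)
From mathcomp Require Import all_boot all_order all_algebra.

Set Implicit Arguments.
Unset Strict Implicit.
Unset Printing Implicit Defensive.

Import GRing.Theory.
Local Open Scope ring_scope.

Definition laminar (t : nat) (T : finType) (F : {set {set T}}) : bool :=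
  [forall A in F, forall B in F,
     (t <= #|A :&: B|)%N ==> (A \subset B) || (B \subset A)].

Definition max_laminar (t n : nat) : nat :=
  \max_(F : {set {set 'I_n}} | laminar t F) #|F|.

(* Integer subtraction, so that [f n + n + 1 = max_laminar 2 n] for every n. *)
Definition f (n : nat) : int := (max_laminar 2 n)%:Z - n%:Z - 1.

(* Main.v *)
Require Import Defs.
From mathcomp Require Import all_boot all_order all_algebra.
From mathcomp Require Import zify ring lra.

Set Implicit Arguments.
Unset Strict Implicit.
Unset Printing Implicit Defensive.

Import Order.TTheory GRing.Theory Num.Theory.

(* Singletons and the empty set account for n + 1 members, so f n counts the
   members of size at least 2.

   Upper bound: adding all pairs keeps the family 2-laminar, and then the maximal
   proper members inside a set S form a linear space on S.  By induction on |S|,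
   the number of members inside S is at most (1219/882) 'C(|S|, 2) minus a
   positive gap, provided that the gaps of the lines add up to at least 1 plus
   the gap of S.  The smallest gap, 1/42, belongs to 7-point lines.  Linear spaces
   on at least 43 points have at least 43 lines (de Bruijn-Erdos); those on 8 to
   42 points have at least 7 lines of size different from 7, because a point lying
   only on 7-point lines and off one of them already forces 43 points.

   Lower bound: the affine plane of order 7 with a Fano plane on each of its 56
   lines gives 1 + 56 * 29 = 1625 members on 49 points.  Transversal designs with
   blocks of size 49 spread this over n points, leaving 49 groups of about n/49
   points each, where the construction is iterated; the limiting ratio would be
   1625/1176, and four iterations are enough. *)

(** * Linear spaces and the de Bruijn-Erdos theorem *)

(** Properness rules out the space with a single line, for which the de Bruijn-Erdos bound fails.
    Cardinality 1 encodes both existence and uniqueness of the joining line. *)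
Record linear_space (T : finType) (S : {set T}) (LL : {set {set T}}) : Prop :=
  LinearSpace {
    line_proper : forall L, L \in LL -> L \proper S;
    line_gt1 : forall L, L \in LL -> 1 < #|L|;
    line_unique : forall x y, x \in S -> y \in S -> x != y ->
      #|[set L in LL | (x \in L) && (y \in L)]| = 1 }.

Section LinearSpace.
Context (T : finType) (S : {set T}) (LL : {set {set T}}).
Context (lsS : linear_space S LL).
Implicit Types (L M : {set T}) (x y : T).

Lemma line_sub L : L \in LL -> L \subset S.
Proof. by move=> /(line_proper lsS)/proper_sub. Qed.

Lemma line_eq L M x y : L \in LL -> M \in LL -> x != y ->
  x \in L -> y \in L -> x \in M -> y \in M -> L = M.
Proof.
move=> LLL MLL xy xL yL xM yM.
have LS := subsetP (line_sub LLL).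
have /eqP/cards1P[N NE] := line_unique lsS (LS _ xL) (LS _ yL) xy.
have : L \in [set N] by rewrite -NE inE LLL xL yL.
have : M \in [set N] by rewrite -NE inE MLL xM yM.
by rewrite !inE => /eqP-> /eqP->.
Qed.

Lemma line_exists x y : x \in S -> y \in S -> x != y ->
  exists2 L, L \in LL & (x \in L) && (y \in L).
Proof.
move=> xS yS xy.
have /eqP/cards1P[L LE] := line_unique lsS xS yS xy.
have : L \in [set L] by rewrite inE.
by rewrite -LE inE => /andP[? ?]; exists L.
Qed.

Lemma sum_incident (P : pred {set T}) (A : {set T}) :
  \sum_(L in LL | P L) #|L :&: A|
  = \sum_(y in A) #|[set L in LL | P L && (y \in L)]|.
Proof.
under eq_bigr => L _ do rewrite -sum1_card.
under [RHS]eq_bigr => y _ do rewrite -sum1_card.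
rewrite (exchange_big_dep (mem A)) /=; last by move=> L y _; rewrite inE => /andP[].
apply: eq_bigr => y yA; apply: eq_bigl => L.
by rewrite !inE yA andbT andbA.
Qed.

(** The lines through [x] partition the remaining points of [S]. *)
Lemma sum_line_through x : x \in S ->
  \sum_(L in LL | x \in L) #|L|.-1 = #|S|.-1.
Proof.
move=> xS; transitivity (\sum_(L in LL | x \in L) #|L :&: (S :\ x)|).
  apply: eq_bigr => L /andP[LLL xL].
  by rewrite setIDA (setIidPl (line_sub LLL)) (cardsD1 x L) xL.
rewrite sum_incident (eq_bigr (fun=> 1)).
  by rewrite sum1_card (cardsD1 x S) xS.
move=> y; rewrite !inE eq_sym => /andP[xy yS].
by have := line_unique lsS xS yS xy.
Qed.

Lemma sum_line_pairs : \sum_(L in LL) 'C(#|L|, 2) = 'C(#|S|, 2).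
Proof.
have bin2E m : 2 * 'C(m, 2) = m * m.-1 by rewrite -mul_bin_diag bin1.
apply/eqP; rewrite -(eqn_pmul2l (isT : 0 < 2)) big_distrr bin2E /=; apply/eqP.
transitivity (\sum_(L in LL) \sum_(x in L) #|L|.-1).
  by apply: eq_bigr => L _; rewrite bin2E sum_nat_const.
rewrite (exchange_big_dep (mem S)) /=; last first.
  by move=> L x LLL; exact: (subsetP (line_sub LLL)).
by rewrite (eq_bigr (fun=> #|S|.-1)) ?sum_nat_const // => x; exact: sum_line_through.
Qed.

(** The lines joining [x] to the points of [L] are pairwise distinct. *)
Lemma line_le_degree x L : L \in LL -> x \in S -> x \notin L ->
  #|L| <= #|[set M in LL | x \in M]|.
Proof.
move=> LLL xS xL.
have -> : #|L| = \sum_(M in LL | x \in M) #|M :&: L|.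
  rewrite sum_incident -sum1_card; apply: eq_bigr => y yL.
  have yS := subsetP (line_sub LLL) _ yL.
  have xy : x != y by apply: contraNneq xL => ->.
  by rewrite -(line_unique lsS xS yS xy).
rewrite -sum1_card; under [X in _ <= X]eq_bigl => M do rewrite inE.
apply: leq_sum => M /andP[MLL xM]; rewrite leqNgt; apply/negP => /card_gt1P[y [z]].
rewrite !inE => -[/andP[yM yL] /andP[zM zL] yz].
by rewrite (line_eq LLL MLL yz) ?xM in xL.
Qed.

(** If [x] and [y] lie on [L] and [z] does not, the line through [y] and [z] misses [x]. *)
Lemma line_missing_point x : 1 < #|S| -> x \in S ->
  exists2 L, L \in LL & x \notin L.
Proof.
move=> S1 xS.
have /card_gt0P[y] : 0 < #|S :\ x| by rewrite (cardsD1 x S) xS in S1.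
rewrite !inE eq_sym => /andP[xy yS].
have [L LLL /andP[xL yL]] := line_exists xS yS xy.
have /properP[_ [z zS zL]] := line_proper lsS LLL.
have yz : y != z by apply: contraNneq zL => <-.
have [M MLL /andP[yM zM]] := line_exists yS zS yz.
exists M => //; apply: contra zL => xM.
by rewrite (line_eq LLL MLL xy).
Qed.

(* Conway's proof: if there are b < n lines, every non-incident pair (x, L)
   satisfies n (b - deg x) < b (n - |L|), whereas the reciprocals of both sides
   add up to 1 over all non-incident pairs. *)
Theorem de_bruijn_erdos : 1 < #|S| -> #|S| <= #|LL|.
Proof.
move=> S1; rewrite leqNgt; apply/negP => bn.
pose b := #|LL|; pose n := #|S|.
pose r x := #|[set L in LL | x \in L]|.
have sE x : #|[set L in LL | x \notin L]| = b - r x.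
  rewrite /b /r -(cardsID [set L : {set T} | x \in L] LL).
  have -> : LL :&: [set L : {set T} | x \in L] = [set L in LL | x \in L].
    by apply/setP => L; rewrite !inE.
  rewrite addnC addnK; congr #|pred_of_set _|.
  by apply/setP => L; rewrite !inE andbC.
have kE L : L \in LL -> #|S :\: L| = n - #|L|.
  by move=> LLL; rewrite cardsDS // line_sub.
have s_gt0 x : x \in S -> 0 < b - r x.
  move=> xS; rewrite -sE; apply/card_gt0P.
  by have [L LLL xL] := line_missing_point S1 xS; exists L; rewrite inE LLL.
have k_gt0 L : L \in LL -> 0 < n - #|L|.
  by move=> LLL; rewrite subn_gt0 proper_card // (line_proper lsS).
have n_gt0 : 0 < n by exact: ltnW.
have [x0 x0S] : exists x, x \in S by apply/card_gt0P.
have [L0 L0LL x0L0] := line_missing_point S1 x0S.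
have b_gt0 : 0 < b by apply/card_gt0P; exists L0.
pose u x : rat := ((n * (b - r x))%:R^-1)%R.
pose v L : rat := ((b * (n - #|L|))%:R^-1)%R.
have uE : (\sum_(x in S) \sum_(L in LL | x \notin L) u x = 1)%R.
  rewrite (eq_bigr (fun=> (n%:R^-1)%R)) => [|x xS].
    by rewrite sumr_const -[LHS]mulr_natl -/n mulfV // pnatr_eq0 -lt0n.
  have -> : (\sum_(L in LL | x \notin L) u x = u x *+ (b - r x))%R.
    by rewrite -sE -sumr_const; apply: eq_bigl => L; rewrite inE.
  rewrite /u -[LHS]mulr_natl natrM invfM mulrCA mulfV ?mulr1 //.
  by rewrite pnatr_eq0 -lt0n s_gt0.
have vE : (\sum_(x in S) \sum_(L in LL | x \notin L) v L = 1)%R.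
  rewrite (exchange_big_dep (mem LL)) /=; last by move=> ? ? _ /andP[].
  rewrite (eq_bigr (fun=> (b%:R^-1)%R)) => [|L LLL].
    by rewrite sumr_const -[LHS]mulr_natl -/b mulfV // pnatr_eq0 -lt0n.
  have -> : (\sum_(x in S | (L \in LL) && (x \notin L)) v L = v L *+ (n - #|L|))%R.
    by rewrite -kE // -sumr_const; apply: eq_bigl => x; rewrite !inE LLL andbC.
  rewrite /v -[LHS]mulr_natl natrM invfM mulrCA mulfV ?mulr1 //.
  by rewrite pnatr_eq0 -lt0n k_gt0.
(* This amounts to b |L| < n deg x, which follows from |L| <= deg x and b < n. *)
have uv x L : x \in S -> L \in LL -> x \notin L -> (v L < u x)%R.
  move=> xS LLL xL; rewrite ltf_pV2 ?posrE ?ltr0n ?muln_gt0 ?n_gt0 ?b_gt0 ?s_gt0 ?k_gt0 //.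
  rewrite ltr_nat; have := line_le_degree LLL xS xL; rewrite -/(r x).
  have := line_gt1 lsS LLL; have := s_gt0 _ xS; have := k_gt0 _ LLL.
  move: bn; rewrite -/b -/n; nia.
suff : (\sum_(x in S) \sum_(L in LL | x \notin L) v L
        < \sum_(x in S) \sum_(L in LL | x \notin L) u x)%R by rewrite uE vE ltxx.
apply: ltr_sum => [|x xS].
  by apply/hasP; exists x0; rewrite // mem_index_enum.
apply: ltr_sum => [|L /andP[LLL xL]]; last exact: uv.
have [L LLL xL] := line_missing_point S1 xS.
by apply/hasP; exists L; rewrite ?mem_index_enum ?LLL.
Qed.

End LinearSpace.

(** * Line sizes and weights in a linear space *)

Lemma card_not7_line (T : finType) (S : {set T}) (LL : {set {set T}}) :
  linear_space S LL -> 7 < #|S| <= 42 ->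
  7 <= #|[set L in LL | #|L| != 7]|.
Proof.
move=> lsS /andP[S8 S42].
have dbe : #|S| <= #|LL| by apply: de_bruijn_erdos => //; lia.
have [/existsP[B /andP[BLL /eqP B7]] | /existsPn no7] :=
  boolP [exists B in LL, #|B| == 7]; last first.
  suff -> : [set L in LL | #|L| != 7] = LL by apply: leq_trans dbe; lia.
  by apply/setP => L; rewrite inE; have := no7 L; case: (L \in LL).
(* A line through [x] of size other than 7; the default [set0] is never reached where [g] is
   used. *)
pose g x := odflt set0 [pick L in LL | (x \in L) && (#|L| != 7)].
have [/forallP hB | /forallPn[p]] :=
  boolP [forall x in B, exists L in LL, (x \in L) && (#|L| != 7)].
  have gP x : x \in B -> [/\ g x \in LL, x \in g x & #|g x| != 7].
    move=> xB; rewrite /g; case: pickP => [L /and3P[] //|no].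
    by have := hB x; rewrite xB /= => /existsP[L]; rewrite no.
  (* A line other than [B] meets [B] in at most one point. *)
  have g_inj : {in B &, injective g}.
    move=> x y xB yB gxy; apply/eqP; apply/idPn => xy.
    have [gLL xg g7] := gP _ xB; have [_ yg _] := gP _ yB; rewrite -gxy in yg.
    by have := line_eq lsS BLL gLL xy xB yB xg yg; move: g7 => /[swap] <-; rewrite B7.
  rewrite -[X in X <= _]B7 -(card_in_imset g_inj); apply: subset_leq_card.
  by apply/subsetP => _ /imsetP[x xB ->]; rewrite inE; have [-> _ ->] := gP _ xB.
rewrite negb_imply => /andP[pB /existsPn hp].
have pS := subsetP (line_sub lsS BLL) _ pB.
have p7 L : L \in LL -> p \in L -> #|L| = 7.
  by move=> LLL pL; apply/eqP; have := hp L; rewrite LLL pL /= negbK.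
have degE : #|S|.-1 = #|[set L in LL | p \in L]| * 6.
  rewrite -(sum_line_through lsS pS) -sum_nat_const.
  under [RHS]eq_bigl => L do rewrite inE.
  by apply: eq_bigr => L /andP[LLL pL]; rewrite p7.
(* A 7-point line missing [p] gives [p] degree at least 7, hence at least 43 points. *)
have [/existsP[C /and3P[CLL /eqP C7 pC]] | /existsPn hC] :=
  boolP [exists C in LL, (#|C| == 7) && (p \notin C)].
  by have := line_le_degree lsS CLL pS pC; lia.
(* Now all 7-point lines pass through [p]. With r of them there are 6r + 1 points, so at least 5r +
   1 other lines, and r is at least 2. *)
have : #|LL| = #|[set L in LL | p \in L]| + #|[set L in LL | #|L| != 7]|.
  rewrite -(cardsID [set L : {set T} | p \in L] LL); congr (_ + _); apply: eq_card => L.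
    by rewrite !inE.
  rewrite !inE andbC; have [LLL /=|//] := boolP (L \in LL).
  have := hC L; rewrite LLL /= negb_and negbK.
  by case: (boolP (p \in L)) => [/(p7 _ LLL)->|_]; rewrite ?orbF.
lia.
Qed.

(* In units of 1/882, [weight k] bounds from below the gap between
   (1219/882) 'C(k, 2) and the number of members of size at least 2 of a
   2-laminar family on k points; the constant 1219/882 = (29 + 1/42)/21 is
   forced by the Fano plane together with linear spaces of 43 lines. *)
Definition weight (k : nat) : nat :=
  if k == 2 then 337 else if (k == 7) || (42 < k) then 21 else 129.

(** This is the gap condition of the induction, multiplied by 882. The weights just suffice: 43 * 21
    = 882 + 21 for many points, 7 * 129 = 882 + 21 for the Fano plane, 3 * 337 = 882 + 129 for the
    triangle. *)
Lemma linear_space_weight (T : finType) (S : {set T}) (LL : {set {set T}}) :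
  linear_space S LL -> 2 < #|S| ->
  882 + weight #|S| <= \sum_(L in LL) weight #|L|.
Proof.
move=> lsS S3.
have dbe : #|S| <= #|LL| by apply: de_bruijn_erdos => //; lia.
have [S43|S42] := ltnP 42 #|S|.
  have : \sum_(L in LL) 21 <= \sum_(L in LL) weight #|L|.
    by apply: leq_sum => L _; rewrite /weight; do ?case: ifP => _.
  have -> : weight #|S| = 21 by rewrite /weight S43 orbT; case: eqP => //; lia.
  by rewrite sum_nat_const; lia.
have Lle L : L \in LL -> #|L| < #|S|.
  by move=> LLL; apply: proper_card; exact: (line_proper lsS LLL).
have splitE (F : {set T} -> nat) : \sum_(L in LL) F L =
    \sum_(L in [set L in LL | #|L| == 2]) F L
    + \sum_(L in [set L in LL | #|L| == 7]) F L
    + \sum_(L in [set L in LL | (#|L| != 2) && (#|L| != 7)]) F L.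
  rewrite (bigID (fun L : {set T} => #|L| == 2)) /= -addnA; congr (_ + _).
    by apply: eq_bigl => L; rewrite inE.
  rewrite (bigID (fun L : {set T} => #|L| == 7)) /=; congr (_ + _).
    apply: eq_bigl => L; rewrite inE -andbA; congr (_ && _).
    by case: (#|L| =P 7) => [->|]; rewrite ?andbF.
  by apply: eq_bigl => L; rewrite inE andbA.
set t2 := [set L in LL | #|L| == 2] in splitE.
set t7 := [set L in LL | #|L| == 7] in splitE.
set t3 := [set L in LL | (#|L| != 2) && (#|L| != 7)] in splitE.
have cardE : #|LL| = #|t2| + #|t7| + #|t3| by rewrite -!sum1_card splitE.
have weightE : \sum_(L in LL) weight #|L| = #|t2| * 337 + #|t7| * 21 + #|t3| * 129.
  rewrite splitE -!sum_nat_const; congr (_ + _ + _); apply: eq_bigr => L; rewrite inE.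
  - by case/andP=> _ /eqP->.
  - by case/andP=> _ /eqP->.
  case/and3P=> /Lle LS /negPf L2 /negPf L7; rewrite /weight L2 L7 /=.
  by case: ltnP => //; lia.
have pairs : #|t2| * 1 + #|t7| * 21 + #|t3| * 3 <= 'C(#|S|, 2).
  rewrite -(sum_line_pairs lsS) splitE -!sum_nat_const; apply: leq_add; first apply: leq_add.
  - by apply: leq_sum => L; rewrite inE => /andP[_ /eqP->].
  - by apply: leq_sum => L; rewrite inE => /andP[_ /eqP->].
  apply: leq_sum => L; rewrite inE => /and3P[LLL /eqP L2 _].
  have L3 : 3 <= #|L| by have := line_gt1 lsS LLL; lia.
  by rewrite (leq_trans _ (leq_bin2l 2 L3)).
rewrite weightE; rewrite cardE in dbe.
have [S8|S7] := ltnP 7 #|S|.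
  have not7 : #|[set L in LL | #|L| != 7]| = #|t2| + #|t3|.
    rewrite -!sum1_card; under eq_bigl do rewrite inE.
    rewrite big_mkcondr /= splitE [X in _ + X + _]big1 ?addn0; first congr (_ + _).
    - by apply: eq_bigr => L; rewrite inE => /andP[_ /eqP->].
    - by apply: eq_bigr => L; rewrite inE => /and3P[_ _ ->].
    - by move=> L; rewrite inE => /andP[_ /eqP->].
  have := card_not7_line lsS; rewrite S8 S42 not7 => /(_ isT) ge7.
  have -> : weight #|S| = 129 by rewrite /weight; do ?case: ifP => //; lia.
  have [S13|S12] := leqP 13 #|S|; first by lia.
  clear - pairs dbe S8 S12 ge7; move: pairs dbe S8 S12 ge7.
  move: #|S| #|t2| #|t7| #|t3| => n a b c pairs dbe S8 S12 ge7.
  have : n \in [:: 8; 9; 10; 11; 12] by rewrite !inE; lia.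
  (* Without 7-point lines, 8 lines of weight at least 129 suffice; otherwise each 7-point line uses
     up 21 of the few pairs. *)
  have [b0|[b1|b2]] : b = 0 \/ b = 1 \/ 2 <= b by lia.
  - by lia.
  - by rewrite !inE => /or4P[||| /orP[]] /eqP nE; move: pairs; rewrite nE bin2 /=; lia.
  - by rewrite !inE => /or4P[||| /orP[]] /eqP nE; move: pairs; rewrite nE bin2 /=; lia.
have t7_0 : #|t7| = 0.
  apply/eqP; rewrite cards_eq0; apply/eqP/setP => L; rewrite !inE.
  by apply/negP => /andP[/Lle + /eqP]; lia.
clear - t7_0 pairs dbe S3 S7; move: t7_0 pairs dbe S3 S7.
move: #|S| #|t2| #|t7| #|t3| => n a b c b0 pairs dbe S3 S7.
have : n \in [:: 3; 4; 5; 6; 7] by rewrite !inE; lia.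
by rewrite !inE => /or4P[||| /orP[]] /eqP nE; move: pairs; rewrite nE bin2 /weight /=; lia.
Qed.

(** * The upper bound for 2-laminar families *)

Lemma laminarP (t : nat) (T : finType) (F : {set {set T}}) :
  reflect (forall A B, A \in F -> B \in F -> t <= #|A :&: B| ->
             (A \subset B) || (B \subset A)) (laminar t F).
Proof.
apply: (iffP forall_inP) => [lamF A B AF BF | lamF A AF].
  by have /forall_inP/(_ _ BF)/implyP := lamF _ AF.
by apply/forall_inP => B BF; apply/implyP; exact: lamF.
Qed.

(** A set of size at most [t] that meets another in at least [t] points is contained in it. *)
Lemma laminar_small (t : nat) (T : finType) (F G : {set {set T}}) :
  (forall A, A \in G -> #|A| <= t) -> laminar t F -> laminar t (F :|: G).
Proof.
move=> Gt /laminarP lamF.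
have small (A B : {set T}) : #|A| <= t -> t <= #|A :&: B| -> A \subset B.
  move=> At tAB; apply/setIidPl/eqP; rewrite eqEcard subsetIl.
  exact: leq_trans tAB.
apply/laminarP => A B; rewrite !inE => /orP[AF|/Gt At] /orP[BF|/Gt Bt] tAB.
- exact: lamF.
- by rewrite orbC small // setIC.
- by rewrite small.
- by rewrite small.
Qed.

Section Members.
Context (T : finType) (F : {set {set T}}).

Definition members (S : {set T}) := [set A in F | (1 < #|A|) && (A \subset S)].

Definition lines (S : {set T}) :=
  [set L in F | (1 < #|L|) && maxset (fun A => (A \in F) && (A \proper S)) L].

Lemma member_in_line (S A : {set T}) :
  A \in F -> 1 < #|A| -> A \proper S -> exists2 L, L \in lines S & A \subset L.
Proof.
move=> AF A1 AS.
have [L maxL AL] := @maxset_exists _ (fun A => (A \in F) && (A \proper S)) A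
  (introT andP (conj AF AS)).
exists L => //; rewrite inE maxL (leq_trans A1 (subset_leq_card AL)) andbT.
have /andP[LF _] : (L \in F) && (L \proper S) := maxsetp maxL.
by rewrite LF.
Qed.

(** The pairs in [F] make every two points lie in a maximal proper member; two such members sharing
    two points are comparable, hence equal. *)
Lemma lines_linear_space (S : {set T}) :
  laminar 2 F -> (forall A : {set T}, #|A| = 2 -> A \in F) -> 2 < #|S| ->
  linear_space S (lines S).
Proof.
move=> /laminarP lamF pairF S3; split=> [L|L|x y xS yS xy].
- by rewrite inE => /and3P[_ _ /maxsetp/andP[]].
- by rewrite inE => /and3P[].
have [|//||L LS] := @member_in_line S [set x; y].
- by rewrite pairF // cards2 xy.
- by rewrite cards2 xy.
- rewrite properEcard cards2 xy S3 andbT.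
  by apply/subsetP => z; rewrite !inE => /orP[] /eqP->.
rewrite subUset !sub1set => /andP[xL yL].
apply/eqP/cards1P; exists L; apply/setP => M; rewrite in_set1 inE.
apply/idP/eqP => [/and3P[MS xM yM]|->]; last by rewrite LS xL.
move: LS MS; rewrite !inE => /and3P[LF _ maxL] /and3P[MF _ maxM].
have LM2 : 2 <= #|L :&: M|.
  have <- : #|[set x; y]| = 2 by rewrite cards2 xy.
  apply: subset_leq_card; apply/subsetP => z.
  by rewrite !inE => /orP[] /eqP->; rewrite ?xL ?xM ?yL ?yM.
have /orP[LM|ML] := lamF _ _ LF MF LM2.
  by apply: (maxsetsup maxL _ LM); exact: (maxsetp maxM).
by apply/esym; apply: (maxsetsup maxM _ ML); exact: (maxsetp maxL).
Qed.

Lemma card_members_le (S : {set T}) :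
  #|members S| <= 1 + \sum_(L in lines S) #|members L|.
Proof.
have sub : members S \subset S |: \bigcup_(L in lines S) members L.
  apply/subsetP => A; rewrite !inE => /and3P[AF A1 AS].
  have [//|AnS /=] := eqVneq A S.
  have [//|//||L LS AL] := @member_in_line S A; first by rewrite properEneq AnS.
  by apply/bigcupP; exists L => //; rewrite inE AF A1.
apply: leq_trans (subset_leq_card sub) _.
apply: leq_trans (leq_card_setU _ _) _; rewrite cards1 leq_add2l.
elim/big_rec2: _ => [|L n A _ IH]; first by rewrite cards0.
by apply: leq_trans (leq_card_setU _ _) _; rewrite leq_add2l.
Qed.

(** Strong induction on |S|: when the bounds for the lines are added, the binomials sum to that of
    [S], and the weights of the lines pay for [S] itself and its own weight. *)
Lemma members_weight (S : {set T}) :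
  laminar 2 F -> (forall A : {set T}, #|A| = 2 -> A \in F) -> 1 < #|S| ->
  882 * #|members S| + weight #|S| <= 1219 * 'C(#|S|, 2).
Proof.
move=> lamF pairF; have [n] := ubnP #|S|; elim: n S => // n IH S Sn S1.
have [S3|S2] := ltnP 2 #|S|; last first.
  have {S1 S2}S2 : #|S| = 2 by lia.
  suff : #|members S| <= 1 by rewrite S2 /weight bin2 /=; lia.
  rewrite -(cards1 S); apply: subset_leq_card; apply/subsetP => A.
  by rewrite !inE => /and3P[_ A1 AS]; rewrite eqEcard AS S2.
have lsS := lines_linear_space lamF pairF S3.
have : \sum_(L in lines S) (882 * #|members L| + weight #|L|)
       <= \sum_(L in lines S) 1219 * 'C(#|L|, 2).
  apply: leq_sum => L LS; apply: IH; last exact: (line_gt1 lsS).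
  by have := proper_card (line_proper lsS LS); lia.
rewrite big_split -!big_distrr /= (sum_line_pairs lsS).
have := linear_space_weight lsS S3; have := card_members_le S.
move: (\sum_(L in _) #|members L|) (\sum_(L in _) weight _) (weight _).
by move: #|members S| (binomial _ _) => *; lia.
Qed.

End Members.

Lemma card_small_sets (T : finType) : #|[set A : {set T} | #|A| <= 1]| = #|T|.+1.
Proof.
have -> : [set A : {set T} | #|A| <= 1] = set0 |: [set [set x] | x : T].
  apply/setP => A; rewrite !inE leq_eqVlt ltnS leqn0 cards_eq0 orbC; congr (_ || _).
  by apply/cards1P/imsetP => [[x ->]|[x _ ->]]; exists x.
rewrite cardsU1 card_imset; last exact: set1_inj.
suff -> : set0 \notin [set [set x] | x : T] by rewrite add1n.
by apply/imsetP => -[x _ /setP/(_ x)]; rewrite !inE eqxx.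
Qed.

Lemma max_laminar_le (n : nat) : 1 < n ->
  882 * max_laminar 2 n + 21 <= 1219 * 'C(n, 2) + 882 * n.+1.
Proof.
move=> n1.
suff bound (F : {set {set 'I_n}}) : laminar 2 F ->
    882 * #|F| + 21 <= 1219 * 'C(n, 2) + 882 * n.+1.
  rewrite /max_laminar; elim/big_ind: _ => [||F]; last exact: bound.
    by have := bound set0; rewrite cards0; apply; apply/laminarP => A B; rewrite inE.
  by move=> a b; rewrite /maxn; case: ifP.
move=> lamF.
pose G := F :|: [set A : {set 'I_n} | #|A| == 2].
have lamG : laminar 2 G by apply: laminar_small => // A; rewrite inE => /eqP->.
have pairG (A : {set _}) : #|A| = 2 -> A \in G by move=> A2; rewrite !inE A2 orbT.
have := members_weight lamG pairG (S := setT); rewrite cardsT card_ord => /(_ n1).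
have : 21 <= weight n by rewrite /weight; do ?case: ifP => _.
suff : #|F| <= #|members G setT| + n.+1 by lia.
have <- : #|[set A : {set 'I_n} | #|A| <= 1]| = n.+1 by rewrite card_small_sets card_ord.
apply: leq_trans (leq_card_setU _ _); apply: subset_leq_card; apply/subsetP => A AF.
by rewrite !inE AF subsetT andbT /=; case: ltnP.
Qed.

(** * Constructions for the lower bound *)

Lemma laminar_imset (t : nat) (T U : finType) (h : T -> U) (F : {set {set T}}) :
  injective h -> laminar t F -> laminar t [set h @: A | A : {set T} in F].
Proof.
move=> h_inj /laminarP lamF; apply/laminarP => _ _ /imsetP[A AF ->] /imsetP[B BF ->].
rewrite -imsetI; last by move=> x y _ _; exact: h_inj.
by rewrite card_imset // => /(lamF _ _ AF BF) /orP[] /imsetS->; rewrite ?orbT.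
Qed.

(** Leaving out sets of size at most 1 keeps families on different blocks disjoint when blocks share
    at most one point. *)
Definition packable (n N : nat) : Prop :=
  exists F : {set {set 'I_n}},
    [/\ laminar 2 F, (forall A, A \in F -> 1 < #|A|) & N <= #|F|].

Lemma packable_card (T : finType) (F : {set {set T}}) :
  laminar 2 F -> (forall A, A \in F -> 1 < #|A|) -> packable #|T| #|F|.
Proof.
move=> lamF F2; exists [set enum_rank @: A | A : {set T} in F]; split.
- exact: laminar_imset enum_rank_inj lamF.
- by move=> _ /imsetP[A AF ->]; rewrite card_imset ?F2 //; exact: enum_rank_inj.
- by rewrite card_imset //; apply: imset_inj; exact: enum_rank_inj.
Qed.

Lemma packable_in (T : finType) (S : {set T}) (N : nat) : packable #|S| N ->
  exists F : {set {set T}}, [/\ laminar 2 F,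
    (forall A, A \in F -> 1 < #|A| /\ A \subset S) & N <= #|F|].
Proof.
case=> F [lamF F2 NF]; have e_inj : injective (@enum_val T (mem S)) by exact: enum_val_inj.
exists [set @enum_val T (mem S) @: A | A : {set _} in F]; split.
- exact: laminar_imset.
- move=> _ /imsetP[A AF ->]; rewrite card_imset ?F2 //; split=> //.
  by apply/subsetP => _ /imsetP[i _ ->]; exact: enum_valP.
- by rewrite card_imset //; exact: imset_inj.
Qed.

Lemma packable_leq (n n' N : nat) : n <= n' -> packable n N -> packable n' N.
Proof.
move=> nn' [F [lamF F2 NF]]; exists [set widen_ord nn' @: A | A : {set _} in F].
have w_inj : injective (widen_ord nn') by move=> i j /(congr1 val)/= ij; exact: val_inj.
split; first exact: laminar_imset.
- by move=> _ /imsetP[A AF ->]; rewrite card_imset ?F2.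
- by rewrite card_imset //; exact: imset_inj.
Qed.

Lemma packable_max_laminar (n N : nat) : packable n N -> N + n.+1 <= max_laminar 2 n.
Proof.
case=> F [lamF F2 NF]; pose G := F :|: [set A : {set 'I_n} | #|A| <= 1].
have lamG : laminar 2 G by apply: laminar_small lamF => A; rewrite inE => /leqW.
apply: leq_trans (leq_bigmax_cond _ lamG); rewrite cardsU card_small_sets card_ord.
rewrite (_ : F :&: _ = set0) ?cards0 ?subn0 ?leq_add2r //; apply/setP => A.
by rewrite !inE; apply/negP => /andP[/F2]; rewrite ltnNge => /negP.
Qed.

(** Members inside different blocks meet in at most one point, so the families of the blocks can be
    united, and the whole set is one further member. *)
Lemma packable_blocks (T J : finType) (B : J -> {set T}) (v : J -> nat) :
  (forall i j x y, x != y -> x \in B i -> y \in B i -> x \in B j -> y \in B j ->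
     i = j) ->
  (forall j, B j != setT) -> (forall j, packable #|B j| (v j)) -> 1 < #|T| ->
  packable #|T| (1 + \sum_j v j).
Proof.
move=> B_inj B_proper /(_ _)/packable_in packB T1.
have [F FP] := fin_all_exists packB.
have F_eq i j A A' : A \in F i -> A' \in F j -> 2 <= #|A :&: A'| -> i = j.
  move=> Ai Aj /card_gt1P[x [y [xA yA xy]]].
  have [_ /(_ _ Ai)[_ /subsetP AB] _] := FP i; have [_ /(_ _ Aj)[_ /subsetP AB'] _] := FP j.
  move: xA yA; rewrite !inE => /andP[xA xA'] /andP[yA yA'].
  by apply: (B_inj _ _ _ _ xy); auto.
pose G := setT |: \bigcup_j F j.
have G2 A : A \in G -> 1 < #|A|.
  rewrite !inE => /orP[/eqP->|/bigcupP[j _ Aj]]; first by rewrite cardsT.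
  by have [_ /(_ _ Aj)[]] := FP j.
have lamG : laminar 2 G.
  apply/laminarP => A A'; rewrite !inE => /orP[/eqP->|/bigcupP[i _ Ai]].
    by rewrite subsetT orbT.
  move=> /orP[/eqP->|/bigcupP[j _ Aj]]; first by rewrite subsetT.
  move=> AA'; have ij := F_eq _ _ _ _ Ai Aj AA'; rewrite -ij in Aj.
  by have [/laminarP lamF _ _] := FP i; exact: lamF.
suff le : 1 + \sum_j v j <= #|G|.
  have [H [lamH H2 GH]] := packable_card lamG G2.
  by exists H; split=> //; exact: leq_trans GH.
have disj i j : i != j -> [disjoint F i & F j].
  move=> ij; apply/pred0Pn => -[A /andP[Ai Aj]]; case/eqP: ij.
  by apply: (F_eq _ _ _ _ Ai Aj); rewrite setIid; have [_ /(_ _ Ai)[]] := FP i.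
rewrite cardsU1; apply: leq_add.
  rewrite lt0b; apply/bigcupP => -[j _ Tj]; have [_ /(_ _ Tj)[_ TB] _] := FP j.
  by have := B_proper j; rewrite eqEsubset TB subsetT.
rewrite -sum1_card partition_disjoint_bigcup //; apply: leq_sum => j _.
by rewrite sum1_card; have [] := FP j.
Qed.

Lemma packable1 (n : nat) : 1 < n -> packable n 1.
Proof.
move=> n1; have := @packable_blocks 'I_n 'I_0 (fun=> set0) (fun=> 0).
by rewrite card_ord big_ord0 addn0; apply=> // -[].
Qed.

Lemma packable3 : packable 3 4.
Proof.
have -> : 4 = 1 + \sum_(j < 3) 1 by rewrite sum1_card card_ord.
have card_pair (j : 'I_3) : #|[set~ j]| = 2 by rewrite cardsC1 card_ord.
rewrite -{1}(card_ord 3); apply: (@packable_blocks _ _ (fun j : 'I_3 => [set~ j])).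
- move=> i j x y xy; rewrite !inE => xi yi xj yj; apply/val_inj.
  move: xy xi yi xj yj; rewrite -!val_eqE /=.
  by move: (ltn_ord i) (ltn_ord j) (ltn_ord x) (ltn_ord y); lia.
- by move=> j; apply/negP => /eqP jT; have := card_pair j; rewrite jT cardsT card_ord.
- by move=> j; rewrite card_pair; exact: packable1.
- by rewrite card_ord.
Qed.

(* The Fano plane: {0, 1, 3} is a perfect difference set modulo 7. *)
Lemma packable7 : packable 7 29.
Proof.
have -> : 29 = 1 + \sum_(j < 7) 4 by rewrite sum_nat_const card_ord.
(* Adding [7 - j] subtracts [j] modulo 7 without truncation. *)
pose b (j x : nat) := (x + (7 - j)) %% 7 \in [:: 0; 1; 3].
have card_line (j : 'I_7) : #|[set x : 'I_7 | b j x]| = 3.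
  rewrite cardsE -sum1_card big_mkcond /= !big_ord_recr big_ord0 /=.
  by case: j; do 7?[case=> //].
rewrite -{1}(card_ord 7).
apply: (@packable_blocks _ _ (fun j : 'I_7 => [set x : 'I_7 | b j x])).
- have check : all (fun i => all (fun j => all (fun x => all (fun y =>
      (x != y) ==> b i x ==> b i y ==> b j x ==> b j y ==> (i == j))
      (iota 0 7)) (iota 0 7)) (iota 0 7)) (iota 0 7) by vm_compute.
  have in7 (i : 'I_7) : val i \in iota 0 7 by rewrite mem_iota /=.
  move=> i j x y xy; rewrite !inE => xi yi xj yj; apply/val_inj/eqP.
  move: check => /allP/(_ _ (in7 i))/allP/(_ _ (in7 j))/allP/(_ _ (in7 x)).
  by move=> /allP/(_ _ (in7 y)); rewrite xi yi xj yj !implyTb (_ : val x != val y).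
- by move=> j; apply/negP => /eqP jT; have := card_line j; rewrite jT cardsT card_ord.
- by move=> j; rewrite card_line; exact: packable3.
- by rewrite card_ord.
Qed.

(* The blocks are those of a transversal design: the graphs of the affine maps
   i |-> a + b i from {0, ..., k - 1} to Z/m, together with the k groups. *)
Lemma packable_transversal (k m N M : nat) : 1 < k -> 1 < m ->
  (forall d, 0 < d < k -> coprime d m) -> packable k N -> packable m M ->
  packable (k * m) (1 + (m ^ 2 * N + k * M)).
Proof.
move=> k1 m1 co packk packm.
have cardZ : #|'Z_m| = m by rewrite card_ord Zp_cast.
pose J : finType := ('Z_m * 'Z_m + 'I_k)%type.
pose B (j : J) : {set 'I_k * 'Z_m} := match j with
  | inl ab => [set (i, ab.1 + ab.2 * (i : nat)%:R)%R | i : 'I_k]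
  | inr i => [set (i, y) | y : 'Z_m] end.
pose v (j : J) := if j is inl _ then N else M.
have cardB j : #|B j| = if j is inl _ then k else m.
  case: j => [ab|i] /=; first by rewrite card_imset ?card_ord // => i i' [].
  by rewrite card_imset ?cardZ // => y y' [].
have BlE ab i y : ((i, y) \in B (inl ab)) = (y == ab.1 + ab.2 * (i : nat)%:R)%R.
  apply/imsetP/eqP => [[i' _ [-> ->]]//|->]; by exists i.
have BrE i' i y : ((i, y) \in B (inr i')) = (i == i').
  by apply/imsetP/eqP => [[y' _ [-> _]]//|->]; exists y.
have card_pts : #|{: 'I_k * 'Z_m}| = k * m by rewrite card_prod cardZ card_ord.
have -> : m ^ 2 * N + k * M = \sum_j v j.
  by rewrite big_sumType /= !sum_nat_const card_prod cardZ card_ord mulnn.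
rewrite -card_pts; apply: (@packable_blocks _ _ B).
- have line_inj ab cd (i i' : 'I_k) : i < i' ->
      (ab.1 + ab.2 * (i : nat)%:R = cd.1 + cd.2 * (i : nat)%:R :> 'Z_m)%R ->
      (ab.1 + ab.2 * (i' : nat)%:R = cd.1 + cd.2 * (i' : nat)%:R :> 'Z_m)%R ->
      ab = cd.
    case: ab cd => [a b] [c d] ii' /= Ei Ei'.
    (* If two graphs agree at [i] and [i'], then (b - d)(i' - i) = 0, and coprimality makes i' - i
       invertible. *)
    have U : ((i' - i)%:R : 'Z_m)%R \is a GRing.unit.
      rewrite unitZpE // coprime_sym co // subn_gt0 ii' /=.
      by rewrite (leq_ltn_trans (leq_subr _ _)).
    have bd : b = d.
      apply: (mulIr U); rewrite natrB 1?ltnW // !mulrBr.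
      have := congr2 (fun y z => y - z)%R Ei' Ei.
      by rewrite !opprD ![(_ + _ + (- _ - _))%R]addrACA !subrr !add0r.
    by rewrite bd in Ei *; rewrite (addIr _ Ei).
  move=> [ab|i0] [cd|i1] [i y] [i' y'].
  + rewrite !BlE => xy /eqP yE /eqP yE' /eqP zE /eqP zE'; congr inl.
    have : i != i' by apply: contraNneq xy => ii'; rewrite yE yE' ii'.
    have Ei := etrans (esym yE) zE; have Ei' := etrans (esym yE') zE'.
    by rewrite neq_ltn => /orP[] lt; exact: (line_inj _ _ _ _ lt).
  + rewrite !BlE !BrE => xy /eqP yE /eqP yE' /eqP iE /eqP iE'.
    by move: xy; rewrite yE yE' iE iE' eqxx.
  + rewrite !BlE !BrE => xy /eqP iE /eqP iE' /eqP yE /eqP yE'.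
    by move: xy; rewrite yE yE' iE iE' eqxx.
  + by rewrite !BrE => _ /eqP <- _ /eqP <-.
- move=> j; apply/negP => /eqP jT; have := cardB j; rewrite jT cardsT card_pts.
  by case: j {jT} => _; nia.
- by move=> j; rewrite cardB; case: j.
- by rewrite card_pts; nia.
Qed.

(** With k = m = 7 the 49 graphs and 7 groups are the lines of the affine plane of order 7. *)
Lemma packable49 : packable 49 1625.
Proof.
have co d : 0 < d < 7 -> coprime d 7.
  by case: d => //; do 6?[case=> //].
exact: (@packable_transversal 7 7 29 29 isT isT co packable7 packable7).
Qed.

(** * Asymptotic density by iterating the construction *)

(** Density is measured against n^2, so [c] corresponds to the ratio 2c against 'C(n, 2). *)
Definition packing_density_ge (R : numDomainType) (c : R) : Prop :=
  exists n0, forall n, n0 <= n -> exists2 N, packable n N & (c * n%:R ^+ 2 <= N%:R)%R.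

(* Taking m = 1 modulo (k - 1)! makes m coprime to 1, ..., k - 1, so that the
   transversal design on k m points exists, and k m misses n by a bounded amount. *)
Lemma transversal_order (k n : nat) : 1 < k -> k <= n ->
  exists m, [/\ k * m <= n, n < k * m + k * (k.-1`!).+1 &
                forall d, 0 < d < k -> coprime d m].
Proof.
move=> k1 kn; set K := k.-1`!; have K0 : 0 < K by exact: fact_gt0.
have q0 : 0 < n %/ k by rewrite divn_gt0 //; lia.
exists ((n %/ k).-1 %/ K * K).+1; split.
- by have := leq_divM (n %/ k).-1 K; have := leq_divM n k; nia.
- by have := ltn_ceil (n %/ k).-1 K0; have := @ltn_ceil n k; nia.
move=> d /andP[d0 dk]; have /dvdnP[q ->] : d %| K by apply: dvdn_fact; lia.
by rewrite -addn1 mulnA /coprime gcdnMDl gcdn1.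
Qed.

(** A transversal design covers all but boundedly many points; [N] per block and density [c] in the
    groups give about m^2 (N + k c) members, against a target of about d (k m)^2. *)
Lemma packing_density_step (R : archiRealFieldType) (k N : nat) (c d : R) :
  1 < k -> packable k N -> (0 <= d)%R -> (d * k%:R ^+ 2 < N%:R + k%:R * c)%R ->
  packing_density_ge c -> packing_density_ge d.
Proof.
move=> k1 packk d0 dc [n0 dens].
pose D := k * (k.-1`!).+1; pose e := (N%:R + k%:R * c - d * k%:R ^+ 2)%R.
have e0 : (0 < e)%R by rewrite subr_gt0.
(* Once [m] is at least [z], [e * m ^ 2] absorbs the lower-order terms of [d * (k * m + D) ^ 2]. *)
pose z := ((2 * d * k%:R * D%:R + d * D%:R ^+ 2) / e)%R.
have z0 : (0 <= z)%R.
  by apply: divr_ge0 (ltW e0); rewrite addr_ge0 ?mulr_ge0 ?exprn_ge0 ?ler0n.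
pose m0 := maxn 2 (maxn n0 (Num.bound z)).
exists (k * m0 + D) => n n_ge.
have [|m [kmn nkm co]] := @transversal_order k n k1; first by nia.
have m_ge : m0 <= m by nia.
have m2 : 1 < m by lia.
have [|M packm cM] := dens m; first by lia.
exists (1 + (m ^ 2 * N + k * M)).
  exact/(packable_leq kmn)/packable_transversal.
have zm : (z <= m%:R)%R.
  apply: le_trans (ltW (archi_boundP z0)) _; rewrite ler_nat; lia.
have nle : (n%:R <= k%:R * m%:R + D%:R :> R)%R by rewrite -natrM -natrD ler_nat; lia.
have zem : (2 * d * k%:R * D%:R + d * D%:R ^+ 2 <= e * m%:R)%R.
  by move: zm; rewrite /z ler_pdivrMr // [(e * _)%R]mulrC.
have -> : ((1 + (m ^ 2 * N + k * M))%:R = 1 + (m%:R ^+ 2 * N%:R + k%:R * M%:R) :> R)%R.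
  by rewrite natrD (natrD _ (_ * _)) (natrM _ (_ ^ _)) natrX natrM.
have m1 : (1 <= m%:R :> R)%R by rewrite ler1n; lia.
have step1 : (d * n%:R ^+ 2 <= d * (k%:R * m%:R + D%:R) ^+ 2)%R.
  by rewrite ler_wpM2l // lerXn2r ?nnegrE ?addr_ge0 ?mulr_ge0 ?ler0n.
have step2 : (d * D%:R ^+ 2 <= d * D%:R ^+ 2 * m%:R)%R.
  by rewrite ler_peMr // mulr_ge0 // exprn_ge0.
have step3 : (k%:R * (c * m%:R ^+ 2) <= k%:R * M%:R)%R by rewrite ler_wpM2l.
have step4 : ((2 * d * k%:R * D%:R + d * D%:R ^+ 2) * m%:R <= e * m%:R * m%:R)%R.
  by rewrite ler_wpM2r.
apply: le_trans step1 _; apply: (@le_trans _ _ (m%:R ^+ 2 * N%:R + k%:R * (c * m%:R ^+ 2))%R).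
  rewrite -subr_ge0 in step2; rewrite -subr_ge0 in step4; rewrite -subr_ge0.
  by apply: le_trans (addr_ge0 step2 step4) _; rewrite le_eqVlt; apply/orP; left; apply/eqP; rewrite /e; ring.
lra.
Qed.

(** The map c |-> (1625 + 49 c) / 49^2 has fixed point 1625/2352 = 0.690901...; each constant is the
    image of the previous one, rounded down. *)
Lemma packing_density_6909 (R : archiRealFieldType) :
  packing_density_ge (6909 / 10000 : R)%R.
Proof.
have step (c d : R) : (0 <= d)%R -> (d * 49 ^+ 2 < 1625 + 49 * c)%R ->
    packing_density_ge c -> packing_density_ge d.
  by move=> d0 dc; exact: (packing_density_step (isT : 1 < 49) packable49 d0 dc).
have dens0 : packing_density_ge (0 : R)%R.
  by exists 2 => n n2; exists 1; [exact: packable1|rewrite mul0r].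
have dens1 : packing_density_ge (6767 / 10000 : R)%R by apply: step dens0; lra.
have dens2 : packing_density_ge (6906 / 10000 : R)%R by apply: step dens1; lra.
(* Any constant between 0.690835 and 0.690895 would do here. *)
have dens3 : packing_density_ge (181 / 262 : R)%R by apply: step dens2; lra.
by apply: step dens3; lra.
Qed.

(* Passage to the lower and upper limits *)
From mathcomp Require Import all_classical all_reals all_analysis.

Local Open Scope ring_scope.
Local Open Scope ereal_scope.

Lemma limn_einf_ge (R : realType) (u : nat -> \bar R) (c : \bar R) (n0 : nat) :
  (forall n, (n0 <= n)%N -> c <= u n) -> c <= limn_einf u.
Proof.
move=> cu; rewrite limn_einf_lim; apply: lime_ge; first exact: is_cvg_einfs.
exists n0 => // n /= n0n; apply: le_ereal_inf_tmp => _ [k /= nk <-].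
by apply: cu; exact: leq_trans nk.
Qed.

Lemma limn_esup_le (R : realType) (u : nat -> \bar R) (c : \bar R) (n0 : nat) :
  (forall n, (n0 <= n)%N -> u n <= c) -> limn_esup u <= c.
Proof.
move=> uc; rewrite limn_esup_lim; apply: lime_le; first exact: is_cvg_esups.
exists n0 => // n /= n0n; apply: ge_ereal_sup => _ [k /= nk <-].
by apply: uc; exact: leq_trans nk.
Qed.

Theorem theorem1p2 (R : realType) :
  (13818 / 10000 : R)%:E <=
    limn_einf (fun n : nat => ((f n)%:~R * ('C(n, 2)%:R)^-1 : R)%:E)
  /\
  limn_esup (fun n : nat => ((f n)%:~R * ('C(n, 2)%:R)^-1 : R)%:E)
    <= (13821 / 10000 : R)%:E.
Proof.
have fE n : ((f n)%:~R = (max_laminar 2 n)%:R - n.+1%:R :> R)%R.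
  by rewrite /f !rmorphB /= -!pmulrn -natr1 opprD addrA.
have bin_gt0 n : (2 <= n)%N -> (0 < 'C(n, 2)%:R :> R)%R.
  by move=> n2; rewrite ltr0n bin_gt0.
have binE n : ('C(n, 2)%:R * 2 = n%:R * (n%:R - 1) :> R)%R.
  case: n => [|n]; first by rewrite bin0n !mul0r.
  rewrite -natrM mulnC -(mul_bin_diag n.+1 1) bin1 natrM /= -natr1; ring.
split.
  have [n0 dens] := packing_density_6909 R.
  apply: (@limn_einf_ge _ _ _ (maxn 2 n0)) => n; rewrite geq_max => /andP[n2 n0n].
  have [N packN densN] := dens n n0n.
  rewrite lee_fin ler_pdivlMr ?bin_gt0 // fE.
  have : (N%:R + n.+1%:R <= (max_laminar 2 n)%:R :> R)%R.
    by rewrite -natrD ler_nat; exact: packable_max_laminar.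
  have := binE n; have : (0 <= n%:R :> R)%R by [].
  (* 0.6909 n^2 is at least 1.3818 'C(n, 2), as n^2 >= n (n - 1). *)
  move: densN; nra.
apply: (@limn_esup_le _ _ _ 2) => n n2.
rewrite lee_fin ler_pdivrMr ?bin_gt0 // fE.
have : (882 * (max_laminar 2 n)%:R + 21 <= 1219 * 'C(n, 2)%:R + 882 * n.+1%:R :> R)%R.
  by rewrite -!natrM -!natrD ler_nat; exact: max_laminar_le.
(* 1219/882 = 1.38208... lies below 1.3821. *)
have := bin_gt0 _ n2; lra.
Qed.
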